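(* Let $R$ be a commutative multiplicative hyperring with identity $1$ and let $I$ be a proper hyperideal of $R$. Then the following statements are equivalent: (1) $I$ is an n-hyperideal of $R$. (2) $I=(I:a)$ for every $a\in R$ with $a\notin r(0)$. (3) For all hyperideals $I_1,I_2$ of $R$, if $I_1\circ I_2\subseteq I$ and $I_1\cap(R\setminus r(0))\neq\varnothing$, then $I_2\subseteq I$.
   Context: A multiplicative hyperring is a nonempty set $R$ with an operation $+$ and a hyperoperation $\circ:R\times R\to P^*(R)$ (where $P^*(R)$ is the set of nonempty subsets of $R$) such that $(R,+)$ is an abelian group; $\circ$ is associative; $a\circ(b+c)\subseteq a\circ b+a\circ c$ and $(b+c)\circ a\subseteq b\circ a+c\circ a$; and $a\circ(-b)=(-a)\circ b=-(a\circ b)$, for all $a,b,c\in R$. For nonempty $A,B\subseteq R$, $A\circ B=\bigcup_{a\in A,b\in B}a\circ b$, $A+B=\{a+b: a\in A,b\in B\}$, $-A=\{-a:a\in A\}$, and elements are identified with singletons in products. $R$ is commutative if $a\circ b=b\circ a$ for all $a,b$; an identity is an element $1$ with $a\in a\circ 1$ for all $a\in R$. A hyperideal is a nonempty $I\subseteq R$ with $a-b\in I$ for $a,b\in I$ and $r\circ x\subseteq I$ for $x\in I$, $r\in R$. Let $\mathbf{C}$ be the class of all finite products $r_1\circ\cdots\circ r_n$ ($r_i\in R$, $n\in\mathbb{N}$); a hyperideal $I$ is a $\mathbf{C}$-hyperideal if for every $A\in\mathbf{C}$, $A\cap I\neq\varnothing$ implies $A\subseteq I$. Standing assumption: all hyperideals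 are $\mathbf{C}$-hyperideals. A prime hyperideal is a proper hyperideal $P$ such that $x\circ y\subseteq P$ implies $x\in P$ or $y\in P$. The prime radical $r(I)$ of a hyperideal $I$ is the intersection of all prime hyperideals containing $I$ (and $r(I)=R$ if there are none); $r(0)$ is the prime radical of the zero hyperideal $\{0\}$. A proper hyperideal $I$ is an n-hyperideal if for all $x,y\in R$, $x\circ y\subseteq I$ and $x\notin r(0)$ imply $y\in I$. For $a\in R$, $(I:a)=\{r\in R: r\circ a\subseteq I\}$. *)

(* Defs.v *)
From HB Require Import structures.
From mathcomp Require Import all_boot all_algebra.
From mathcomp Require Import boolp classical_sets.

Set Implicit Arguments.
Unset Strict Implicit.
Unset Printing Implicit Defensive.

Import GRing.Theory.
Local Open Scope classical_set_scope.
Local Open Scope ring_scope.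

Definition add_set (R : zmodType) (A B : set R) : set R :=
  [set a + b | a in A & b in B].

Definition opp_set (R : zmodType) (A : set R) : set R := [set - a | a in A].

Definition lift_hop (T : Type) (op : T -> T -> set T) (A B : set T) : set T :=
  \bigcup_(a in A) \bigcup_(b in B) op a b.

HB.mixin Record Zmodule_isMulHyperring R of GRing.Zmodule R := {
  hmul : R -> R -> set R;
  hmul_nonempty : forall a b, hmul a b !=set0;
  hmulA : forall a b c,
    lift_hop hmul (hmul a b) [set c] = lift_hop hmul [set a] (hmul b c);
  hmulDr : forall a b c, hmul a (b + c) `<=` add_set (hmul a b) (hmul a c);
  hmulDl : forall a b c, hmul (b + c) a `<=` add_set (hmul b a) (hmul c a);
  hmulrN : forall a b, hmul a (- b) = opp_set (hmul a b);
  hmulNr : forall a b, hmul (- a) b = opp_set (hmul a b)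
}.

#[short(type="mulHyperringType")]
HB.structure Definition MulHyperring :=
  { R of Zmodule_isMulHyperring R & GRing.Zmodule R }.

Definition hmul_set (R : mulHyperringType) : set R -> set R -> set R :=
  lift_hop (@hmul R).

Section Hyperideals.
Variable R : mulHyperringType.
Implicit Types (I P A : set R) (r a : R) (s : seq R).

Definition hcommutative := forall a b : R, hmul a b = hmul b a.

Definition hidentity (e : R) := forall a : R, hmul a e a.

(* [hprod r s] is r o s_1 o ... o s_k; the class C consists of these sets, so
   a product has at least one factor, and {r} is a product. *)
Definition hprod r s : set R :=
  foldl (fun A t => hmul_set A [set t]) [set r] s.

Definition hyperideal I :=
  [/\ I !=set0,
      forall a b, I a -> I b -> I (a - b)
    & forall r x, I x -> hmul r x `<=` I].

Definition C_hyperideal I :=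
  hyperideal I /\
  forall r s, hprod r s `&` I !=set0 -> hprod r s `<=` I.

Definition proper_hyperideal I := hyperideal I /\ I <> setT.

Definition prime_hyperideal P :=
  proper_hyperideal P /\ forall x y, hmul x y `<=` P -> P x \/ P y.

(* The empty intersection is [setT]. *)
Definition prime_radical A : set R :=
  \bigcap_(P in [set P | prime_hyperideal P /\ A `<=` P]) P.

Definition n_hyperideal I :=
  proper_hyperideal I /\
  forall x y, hmul x y `<=` I -> ~ prime_radical [set 0] x -> I y.

Definition hcolon I a : set R := [set r | hmul r a `<=` I].

End Hyperideals.

Arguments hcommutative : clear implicits.

(* Main.v *)
Require Import Defs.
From HB Require Import structures.
From mathcomp Require Import all_boot all_algebra.
From mathcomp Require Import boolp classical_sets.

Local Open Scope classical_set_scope.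
Local Open Scope ring_scope.

(** Condition (2) is the definition of an n-hyperideal read elementwise: the
    inclusion of [I] in [(I : a)] always holds, and the reverse inclusion says
    that [r o a] inside [I] with [a] outside [r(0)] forces [r] into [I].
    Likewise (1) gives (3) by picking a point of [I1] outside [r(0)].

    The only construction is in (3) => (1).  Given [x o y] inside [I], one needs
    hyperideals containing [x] and [y] whose product stays in [I].  Principal
    hyperideals would require describing their elements; residuals avoid this.
    Take [I2 = (I : x)] and [I1 = (I : I2)]: by commutativity [y] is in [I2]
    and [x] is in [I1], and [I1 o I2] lies in [I] by the very definition of
    [I1].  It remains to see that residuals of [I] are hyperideals
    ([hyperideal_hresidual]). *)

Definition hresidual {R : mulHyperringType} (I A : set R) : set R :=
  \bigcap_(a in A) hcolon I a.

Section Residuals.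
Context {R : mulHyperringType} (R_comm : hcommutative R).
Context {I : set R} (I_ideal : hyperideal I).

Lemma hyperideal0 : I 0.
Proof.
case: I_ideal => -[x Ix] IB _.
by rewrite -(GRing.subrr x); apply: IB.
Qed.

Lemma hcolonC {a b} : hcolon I a b -> hcolon I b a.
Proof. by rewrite /hcolon /= R_comm. Qed.

Lemma hyperideal_sub_hcolon a : I `<=` hcolon I a.
Proof. by case: I_ideal => _ _ IM r Ir; apply/hcolonC/IM. Qed.

(** Weak distributivity suffices for closure under subtraction, because only
    the inclusion of [(b - c) o a] in [b o a - c o a] is used; closure under
    multiplication is associativity, [(r o b) o a = r o (b o a)]. *)
Lemma hyperideal_hcolon a : hyperideal (hcolon I a).
Proof.
case: (I_ideal) => _ IB IM; split.
- by exists 0; apply: hyperideal_sub_hcolon hyperideal0.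
- move=> b c Ib Ic z /hmulDl[u bau [v]].
  rewrite hmulNr => -[w caw <-] <-.
  by apply: IB; [apply: Ib | apply: Ic].
- move=> r b Ib t rbt z taz.
  have : lift_hop hmul (hmul r b) [set a] z by exists t => //; exists a.
  rewrite hmulA => -[_ -> [w baw rwz]].
  exact: IM (Ib _ baw) _ rwz.
Qed.

Lemma hyperideal_hresidual A : hyperideal (hresidual I A).
Proof.
split.
- by exists 0 => a _; apply: hyperideal_sub_hcolon hyperideal0.
- move=> b c Ab Ac a Aa; have [_ IB _] := hyperideal_hcolon a.
  by apply: IB; [apply: Ab | apply: Ac].
- move=> r b Ab t rbt a Aa; have [_ _ IM] := hyperideal_hcolon a.
  exact: IM (Ab _ Aa) _ rbt.
Qed.

End Residuals.

Theorem theorem5p5 (R : mulHyperringType) (one : R)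
  (R_comm : hcommutative R) (R_one : hidentity one)
  (R_C : forall J : set R, hyperideal J -> C_hyperideal J)
  (I : set R) (I_proper : proper_hyperideal I) :
  (n_hyperideal I <->
     (forall a : R, ~ prime_radical [set 0] a -> I = hcolon I a)) /\
  (n_hyperideal I <->
     (forall I1 I2 : set R, hyperideal I1 -> hyperideal I2 ->
        hmul_set I1 I2 `<=` I ->
        I1 `&` (setT `\` prime_radical [set 0]) !=set0 ->
        I2 `<=` I)).
Proof.
have [I_ideal _] := I_proper.
split; split.
- move=> [_ nI] a a_nrad; rewrite eqEsubset; split.
    exact: hyperideal_sub_hcolon.
  by move=> r /(hcolonC R_comm) Iar; apply: nI Iar a_nrad.
- move=> I_colon; split=> // x y Ixy x_nrad.
  by rewrite (I_colon x x_nrad); apply: hcolonC.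
- move=> [_ nI] I1 I2 _ _ I12 [x [I1x [_ x_nrad]]] y I2y.
  apply: nI x_nrad => z xyz.
  by apply: I12; exists x => //; exists y.
- move=> I_prod; split=> // x y Ixy x_nrad.
  apply: (I_prod (hresidual I (hcolon I x)) (hcolon I x)).
  + exact: hyperideal_hresidual.
  + exact: hyperideal_hcolon.
  + by move=> z [b Jb [a Ia baz]]; apply: Jb Ia _ baz.
  + by exists x; split=> // a; apply: hcolonC.
  + exact: hcolonC.
Qed.
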